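(* Let $p\in(1,\infty)$ and let $\Theta\subset\mathbb{R}^d$ be a parameter set that generates a smooth submanifold $\mathcal{M}(\Theta)=\{\mu_\theta:\theta\in\Theta\}\subset\mathbb{W}_p(\mathbb{R}^m)$ such that $(\mathcal{M}(\Theta),W_p)$ is isometric up to a constant to $(\Theta,|\cdot|_{\mathbb{R}^d})$, i.e. there is a constant $c>0$ with $W_p(\mu_\theta,\mu_{\theta'})=c|\theta-\theta'|$ for all $\theta,\theta'\in\Theta$. If $\{\theta_i\}_{i=1}^N\subset\Theta$ and $\{\mu_{\theta_i}\}_{i=1}^N\subset\mathcal{M}(\Theta)$ are the corresponding measures, then the Functional Wassmap algorithm with exponent $p$ and embedding dimension $d$, applied to $\{\mu_{\theta_i}\}_{i=1}^N$, recovers $\{\theta_i\}_{i=1}^N$ up to rigid transformation and global scaling.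
   Context: $\mathbb{W}_p(\mathbb{R}^m)$ is the set of Borel probability measures $\mu$ on $\mathbb{R}^m$ with $\int|x|^p\,d\mu<\infty$, with the $p$-Wasserstein distance $W_p(\mu,\nu)=\inf_{\gamma}\left(\int_{\mathbb{R}^{2m}}|x-y|^p\,d\gamma(x,y)\right)^{1/p}$, the infimum being over all couplings $\gamma$ of $\mu$ and $\nu$; $|\cdot|$ is the Euclidean norm. ''Smooth submanifold'' refers to the parametrized family $\mathcal{M}(\Theta)$ viewed as a subset of $\mathbb{W}_p(\mathbb{R}^m)$ with the metric $W_p$; no specific smooth structure is specified. Functional Wassmap algorithm (exponent $p$, embedding dimension $d$). Input: measures $\mu_1,\dots,\mu_N\in\mathbb{W}_p(\mathbb{R}^m)$. (1) Form the $N\times N$ matrix $W$ with $W_{ij}=W_p(\mu_i,\mu_j)^2$. (2) Set $B=-\tfrac12 HWH$ with $H=I-\tfrac1N\mathbb{1}_N$, where $\mathbb{1}_N$ is the $N\times N$ all-ones matrix. (3) Take the truncated eigendecomposition $B_d=V_d\Lambda_dV_d^T$, where $\Lambda_d$ is the diagonal matrix of the $d$ largest eigenvalues of $B$ and the columns of $V_d$ are corresponding orthonormal eigenvectors (if $d>N$, pad with zero columns). (4) Output $z_i=$ the $i$-th row of $V_d\Lambda_d^{1/2}$, $i=1,\dots,N$, as points in $\mathbb{R}^d$. The algorithm recovers $\{y_i\}_{i=1}^N\subset\mathbb{R}^d$ up to rigid transformation if the eigenvalues in $\Lambda_d$ are nonnegative and, for any choice of eigenvectors, there is a Euclidean isometry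 $R(x)=Qx+b$ of $\mathbb{R}^d$ ($Q$ orthogonal) with $z_i=R(y_i)$ for all $i$. It recovers $\{\theta_i\}$ up to rigid transformation and global scaling if it recovers $\{a\theta_i\}$ up to rigid transformation for some constant $a>0$. *)

(* Defs.v *)
From HB Require Import structures.
From mathcomp Require Import all_boot all_order all_algebra.
From mathcomp Require Import all_classical all_reals all_analysis.

Set Implicit Arguments.
Unset Strict Implicit.
Unset Printing Implicit Defensive.

Import Order.TTheory GRing.Theory Num.Theory.
Import numFieldNormedType.Exports.

Local Open Scope classical_set_scope.
Local Open Scope ring_scope.

(* The canonical norm of 'rV[R]_n in the library is the sup norm, hence a
   separate Euclidean norm.  Both induce the same topology. *)
Definition eucl_norm (R : realType) (n : nat) (x : 'rV[R]_n) : R :=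
  Num.sqrt (\sum_(i < n) x ord0 i ^+ 2).

Definition eucl_dist (R : realType) (n : nat) (x y : 'rV[R]_n) : R := eucl_norm (x - y).

(* R^m with its Borel sigma-algebra. *)
Definition borelRV (R : realType) (m : nat) : measurableType _ :=
  g_sigma_algebraType (@open 'rV[R]_m).

Definition wasserstein_space (R : realType) (m : nat) (p : R) :
    set (probability (borelRV R m) R) :=
  [set mu : probability (borelRV R m) R |
    (\int[mu]_x (eucl_norm (x : 'rV[R]_m) `^ p)%:E < +oo)%E].

(* The product sigma-algebra of R^m x R^m is the Borel sigma-algebra
   of R^(2m). *)
Definition couplings (R : realType) (m : nat)
    (mu nu : probability (borelRV R m) R) :
    set (probability (borelRV R m * borelRV R m)%type R) :=
  [set g | (forall A, measurable A -> g (fst @^-1` A) = mu A) /\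
           (forall A, measurable A -> g (snd @^-1` A) = nu A)].

(* Extended-real valued; finite on wasserstein_space p. *)
Definition wasserstein (R : realType) (m : nat) (p : R)
    (mu nu : probability (borelRV R m) R) : \bar R :=
  ereal_inf [set ((\int[g]_z (eucl_dist z.1 z.2 `^ p)%:E) `^ p^-1)%E
            | g in couplings mu nu].

Definition sqdist_matrix (R : realType) (m N : nat) (p : R)
    (mu : 'I_N -> probability (borelRV R m) R) : 'M[R]_N :=
  \matrix_(i, j) fine (wasserstein p (mu i) (mu j)) ^+ 2.

Definition centering (R : realType) (N : nat) : 'M[R]_N :=
  1%:M - N%:R^-1 *: const_mx 1.

Definition wassmap_gram (R : realType) (m N : nat) (p : R)
    (mu : 'I_N -> probability (borelRV R m) R) : 'M[R]_N :=
  - (2^-1) *: (centering R N *m sqdist_matrix p mu *m centering R N).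

(* s lists the eigenvalues of B with multiplicity, in nonincreasing order. *)
Definition eigenvalue_list (R : realType) (N : nat) (B : 'M[R]_N)
    (s : seq R) : Prop :=
  char_poly B = \prod_(x <- s) ('X - x%:P) /\ sorted >=%R s.

(* L is the diagonal of Lambda_d.  The list s has length N, so that when N < d
   the default value of s`_k makes the entries of L of index >= N equal to 0. *)
Definition truncated_eigendecomposition (R : realType) (N d : nat)
    (B : 'M[R]_N) (L : 'rV[R]_d) (V : 'M[R]_(N, d)) : Prop :=
  exists s : seq R,
    [/\ eigenvalue_list B s,
        forall k : 'I_d, L ord0 k = s`_k,
        forall k : 'I_d, (k < N)%N -> B *m col k V = L ord0 k *: col k V,
        forall k l : 'I_d, (k < N)%N -> (l < N)%N ->
          \sum_(i < N) V i k * V i l = (k == l)%:R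
      & forall k : 'I_d, (N <= k)%N -> col k V = 0].

(* A relation and not a function, since the eigenvectors are not unique; L is
   unique.  An output always exists by the spectral theorem, because
   wassmap_gram p mu is a real symmetric matrix. *)
Definition functional_wassmap (R : realType) (m N d : nat) (p : R)
    (mu : 'I_N -> probability (borelRV R m) R)
    (L : 'rV[R]_d) (z : 'I_N -> 'rV[R]_d) : Prop :=
  exists V : 'M[R]_(N, d),
    truncated_eigendecomposition (wassmap_gram p mu) L V /\
    forall i : 'I_N, z i = row i (V *m diag_mx (map_mx Num.sqrt L)).

(* Points are row vectors: x *m Q^T is the row form of Q x. *)
Definition recovers_rigid (R : realType) (m N d : nat) (p : R)
    (mu : 'I_N -> probability (borelRV R m) R)
    (y : 'I_N -> 'rV[R]_d) : Prop :=
  forall (L : 'rV[R]_d) (z : 'I_N -> 'rV[R]_d), functional_wassmap p mu L z ->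
    (forall k : 'I_d, 0 <= L ord0 k) /\
    exists (Q : 'M[R]_d) (b : 'rV[R]_d),
      Q^T *m Q = 1%:M /\ forall i : 'I_N, z i = y i *m Q^T + b.

Definition recovers_rigid_scaling (R : realType) (m N d : nat) (p : R)
    (mu : 'I_N -> probability (borelRV R m) R)
    (y : 'I_N -> 'rV[R]_d) : Prop :=
  exists2 a : R, 0 < a & recovers_rigid p mu (fun i => a *: y i).

(* Main.v *)
(** W_ij is the squared Euclidean distance of the points y_i = c theta_i, so
    double centering turns W into B = G G^T, where the rows of G are the y_i
    minus their barycentre.  As G has only d columns, B has rank at most d and
    truncating its eigendecomposition loses nothing: Z Z^T = B for the output Z.
    Two families of vectors with the same Gram matrix differ by an orthogonal
    map. *)
Require Import Defs.
From mathcomp Require Import all_boot all_order all_algebra.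
From mathcomp Require Import all_classical all_reals all_analysis.
From mathcomp Require Import ring.
Set Implicit Arguments.
Unset Strict Implicit.
Unset Printing Implicit Defensive.
Import Order.TTheory GRing.Theory Num.Theory.
Local Open Scope classical_set_scope.
Local Open Scope ring_scope.

(** * Families of vectors with equal Gram matrices *)

Lemma mxtrace_mulmx_tr (R : comNzRingType) (m n : nat) (A : 'M[R]_(m, n)) :
  \tr (A *m A^T) = \sum_i \sum_j A i j ^+ 2.
Proof.
by apply: eq_bigr => i _; rewrite mxE; apply: eq_bigr => j _; rewrite mxE expr2.
Qed.

Lemma mxtrace_mulmx_tr_eq0 (R : realDomainType) (m n : nat) (A : 'M[R]_(m, n)) :
  \tr (A *m A^T) = 0 -> A = 0.
Proof.
rewrite mxtrace_mulmx_tr => h; apply/matrixP => i j; rewrite mxE.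
have /(_ i isT) hi := psumr_eq0P (fun k _ => sumr_ge0 _ (fun l _ => sqr_ge0 (A k l))) h.
have /(_ j isT) hj := psumr_eq0P (fun l _ => sqr_ge0 (A i l)) hi.
by apply/eqP; rewrite -sqrf_eq0 hj.
Qed.

Lemma mulmx_tr_eq0 (R : realDomainType) (m n : nat) (A : 'M[R]_(m, n)) :
  A *m A^T = 0 -> A = 0.
Proof. by move=> h; apply: mxtrace_mulmx_tr_eq0; rewrite h mxtrace0. Qed.

(* With 0^-1 = 0, householder 0 is the identity. *)
Definition householder (R : fieldType) (d : nat) (w : 'rV[R]_d) : 'M[R]_d :=
  1%:M - (2 / (w *m w^T) 0 0) *: (w^T *m w).

Lemma householder_orthogonal (R : fieldType) (d : nat) (w : 'rV[R]_d) :
  householder w *m (householder w)^T = 1%:M.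
Proof.
rewrite /householder; set s := (w *m w^T) 0 0; set W := w^T *m w.
have trW : W^T = W by rewrite trmx_mul trmxK.
have WW : W *m W = s *: W.
  by rewrite /W mulmxA -(mulmxA w^T) [w *m w^T]mx11_scalar mul_mx_scalar -scalemxAl.
rewrite [(_ - _)^T]linearB /= [(_ *: W)^T]linearZ /= trmx1 trW mulmxBl mul1mx mulmxBr mulmx1.
rewrite -scalemxAl -scalemxAr WW !scalerA opprB.
(* If [s] is 0, so is [2 / s], and both sides vanish. *)
have -> : 2 / s * (2 / s) * s = 2 / s + 2 / s.
  have [->|s0] := eqVneq s 0; first by rewrite invr0 !(mulr0, mul0r) addr0.
  by field.
by rewrite scalerDl addrK addrNK.
Qed.

Lemma householder_fix (R : fieldType) (d : nat) (w x : 'rV[R]_d) :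
  x *m w^T = 0 -> x *m householder w = x.
Proof. by move=> xw; rewrite mulmxBr mulmx1 -scalemxAr mulmxA xw mul0mx scaler0 subr0. Qed.

(** Equal norms give |w|^2 = 2 <u, w> for w = u - z, so the reflection subtracts exactly w from
    u. *)
Lemma householder_swap (R : realFieldType) (d : nat) (u z : 'rV[R]_d) :
  u *m u^T = z *m z^T -> u *m householder (u - z) = z.
Proof.
move=> uz; rewrite mulmxBr mulmx1 -scalemxAr mulmxA.
set w := u - z; have [w0|w0] := eqVneq w 0.
  by rewrite w0 mulmx0 scaler0 subr0; apply/eqP; rewrite -subr_eq0 -/w w0.
have zu : z *m u^T = u *m z^T.
  by rewrite [RHS]mx11_scalar -tr_scalar_mx -mx11_scalar trmx_mul trmxK.
have ww : w *m w^T = 2 *: (u *m w^T).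
  rewrite /w linearB /= mulmxBl !mulmxBr zu -uz scaler_nat mulr2n.
  by rewrite opprB.
have s0 : (w *m w^T) 0 0 != 0.
  by apply: contraNneq w0 => s0; apply/eqP/mulmx_tr_eq0; rewrite [LHS]mx11_scalar s0 raddf0.
rewrite [u *m _]mx11_scalar mul_scalar_mx scalerA.
have -> : 2 / (w *m w^T) 0 0 * (u *m w^T) 0 0 = 1.
  by move: s0; rewrite ww mxE => s0; rewrite mulrAC divff.
by rewrite scale1r /w opprB addrC subrK.
Qed.

(* Rows are matched one at a time: once the first rows agree, the Householder
   reflection exchanging the next row of A with that of C fixes them, since
   their inner products with both are equal. *)
Lemma gram_eq_orthogonal (R : realFieldType) (N d : nat) (A C : 'M[R]_(N, d)) :
  A *m A^T = C *m C^T -> exists2 Q : 'M[R]_d, Q *m Q^T = 1%:M & A *m Q = C.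
Proof.
move=> AC.
suff: forall n, (n <= N)%N -> exists2 Q : 'M[R]_d, Q *m Q^T = 1%:M &
    forall i : 'I_N, (i < n)%N -> row i (A *m Q) = row i C.
  move=> /(_ N (leqnn N))[Q QQ hQ]; exists Q => //.
  by apply/row_matrixP => i; apply: hQ.
elim=> [_|n IH nN]; first by exists 1%:M; rewrite // trmx1 mulmx1.
have [Q QQ hQ] := IH (ltnW nN); pose k := Ordinal nN.
have gram (i j : 'I_N) :
    row i (A *m Q) *m (row j (A *m Q))^T = row i C *m (row j C)^T.
  have rowM (M : 'M[R]_(N, d)) : row i M *m (row j M)^T = row i (col j (M *m M^T)).
    by apply/matrixP => a b; rewrite !mxE; apply: eq_bigr => l _; rewrite !mxE.
  by rewrite !rowM trmx_mul mulmxA -(mulmxA A) QQ mulmx1 AC.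
exists (Q *m householder (row k (A *m Q) - row k C)).
  by rewrite trmx_mul mulmxA -(mulmxA Q) householder_orthogonal mulmx1.
move=> i; rewrite ltnS leq_eqVlt mulmxA row_mul => /predU1P[ik|lt_in].
  have -> : i = k by apply/val_inj.
  by apply: householder_swap; apply: gram.
rewrite householder_fix ?(hQ _ lt_in) // [(_ - _)^T]linearB mulmxBr -gram.
by rewrite (hQ _ lt_in) subrr.
Qed.

(** * Spectrum and truncation of a Gram matrix *)

Lemma mxtrace_char_poly_roots (R : idomainType) (N : nat) (B : 'M[R]_N) (s : seq R) :
  char_poly B = \prod_(x <- s) ('X - x%:P) -> \tr B = \sum_(x <- s) x.
Proof.
move=> Bs.
have sN : size s = N.
  by apply: succn_inj; rewrite -(size_char_poly B) Bs size_prod_XsubC.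
(* The trace is read off the coefficient of degree N - 1, which requires N > 0. *)
have [N0|N0] := posnP N.
  have /size0nil -> : size s = 0 by rewrite sN.
  by move: B {Bs sN}; rewrite N0 => B; rewrite /mxtrace big_ord0 big_nil.
apply: oppr_inj; rewrite -(char_poly_trace B N0) Bs -sN coefPn_prod_XsubC //.
by rewrite sN -lt0n.
Qed.

(** If v G G^T = x v, then x |v|^2 = |v G|^2. *)
Lemma eigenvalue_gram_ge0 (R : realFieldType) (N d : nat) (G : 'M[R]_(N, d)) (x : R) :
  eigenvalue (G *m G^T) x -> 0 <= x.
Proof.
have norm_ge0 n (u : 'rV[R]_n) : 0 <= (u *m u^T) 0 0.
  by rewrite mxE; apply: sumr_ge0 => i _; rewrite mxE -expr2 sqr_ge0.
case/eigenvalueP => v vG v0.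
have v_gt0 : 0 < (v *m v^T) 0 0.
  rewrite lt_def norm_ge0 andbT; apply: contraNneq v0 => v0.
  by apply/eqP/mulmx_tr_eq0; rewrite [LHS]mx11_scalar v0 raddf0.
rewrite -(pmulr_lge0 _ v_gt0); suff -> : x * (v *m v^T) 0 0 = ((v *m G) *m (v *m G)^T) 0 0.
  exact: norm_ge0.
by rewrite trmx_mul mulmxA -(mulmxA v) vG -scalemxAl [RHS]mxE.
Qed.

(** The error B - V L V^T is itself a Gram matrix, that of P G with P = 1 - V V^T, so it vanishes as
    soon as P G does. *)
Lemma truncated_eigendecomposition_gram (R : realType) (N d : nat)
    (G : 'M[R]_(N, d)) (L : 'rV[R]_d) (V : 'M[R]_(N, d)) :
  truncated_eigendecomposition (G *m G^T) L V ->
  (forall k, 0 <= L ord0 k) /\ V *m diag_mx L *m V^T = G *m G^T.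
Proof.
set B := G *m G^T; case=> s [[Bs s_sorted] Ls BV VV V0].
have trB : B^T = B by rewrite trmx_mul trmxK.
have sN : size s = N.
  by apply: succn_inj; rewrite -(size_char_poly B) Bs size_prod_XsubC.
have s_ge0 j : 0 <= s`_j.
  have [js|js] := ltnP j (size s); last by rewrite nth_default.
  apply: (@eigenvalue_gram_ge0 _ _ _ G).
  by rewrite eigenvalue_root_char Bs root_prod_XsubC mem_nth.
have L0 (k : 'I_d) : (N <= k)%N -> L ord0 k = 0.
  by move=> Nk; rewrite Ls nth_default // sN.
split=> [k|]; first by rewrite Ls.
have BVL : B *m V = V *m diag_mx L.
  apply/matrixP => i k; rewrite mul_mx_diag [LHS]mxE [RHS]mxE.
  have [kN|Nk] := ltnP k N.
    have /matrixP/(_ i ord0) := BV k kN; rewrite [LHS]mxE [RHS]mxE mulrC [col k V i _]mxE => <-.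
    by apply: eq_bigr => j _; rewrite [col k V j _]mxE.
  have Vk j : V j k = 0 by have /matrixP/(_ j ord0) := V0 k Nk; rewrite !mxE.
  by rewrite Vk mul0r big1 // => j _; rewrite Vk mulr0.
(* Only the first N columns of [V] are orthonormal; any further ones are zero padding. *)
have VtV : V^T *m V = diag_mx (\row_(k < d) (k < N)%N%:R).
  apply/matrixP => k l; rewrite !mxE.
  have [kN|Nk] := ltnP k N; last first.
    rewrite mul0rn big1 // => i _; rewrite mxE.
    by have /matrixP/(_ i ord0) := V0 k Nk; rewrite !mxE => ->; rewrite mul0r.
  have [lN|Nl] := ltnP l N.
    by rewrite -[RHS]/((k == l)%:R) -(VV k l kN lN); apply: eq_bigr => i _; rewrite mxE.
  have /negPf -> : k != l by apply: contraTneq kN => ->; rewrite -leqNgt.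
  rewrite mulr0n big1 // => i _.
  by have /matrixP/(_ i ord0) := V0 l Nl; rewrite !mxE => ->; rewrite mulr0.
have VVV : V *m (V^T *m V) = V.
  rewrite VtV mul_mx_diag; apply/matrixP => i k; rewrite !mxE.
  have [kN|Nk] := ltnP k N; first by rewrite mulr1.
  by have /matrixP/(_ i ord0) := V0 k Nk; rewrite !mxE => ->; rewrite mul0r.
(* Orthogonal projection onto the complement of the column span of [V]. *)
pose P := 1%:M - V *m V^T.
have trP : P^T = P by rewrite [LHS]linearB /= trmx1 trmx_mul trmxK.
have PV : P *m V = 0 by rewrite mulmxBl mul1mx -mulmxA VVV subrr.
(* Since P B V = P V L = 0, P B P = P B = B - V V^T B, and V^T B = L V^T by symmetry of [B]. *)
have PBP : (P *m G) *m (P *m G)^T = B - V *m diag_mx L *m V^T.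
  rewrite trmx_mul trP mulmxA -(mulmxA P) -/B -mulmxA [B *m P]mulmxBr mulmx1.
  rewrite [B *m (V *m _)]mulmxA BVL mulmxBr !mulmxA PV !mul0mx subr0.
  rewrite -(mulmxA P) -/B mulmxBl mul1mx; congr (_ - _).
  by rewrite -{1}trB -!mulmxA -trmx_mul BVL trmx_mul tr_diag_mx.
suff PG : P *m G = 0.
  by apply/esym/eqP; rewrite -subr_eq0 -PBP PG mul0mx.
have [/andP[dN /forallP Lneq0]|] := boolP ((d <= N)%N && [forall k, L ord0 k != 0]).
  (* G^T V is a square matrix whose Gram matrix diag L is invertible. *)
  have VtV1 : V^T *m V = 1%:M.
    rewrite VtV -diag_const_mx; congr diag_mx; apply/rowP => k; rewrite !mxE.
    by rewrite (leq_trans (ltn_ord k) dN).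
  have Mu : G^T *m V \in unitmx.
    have : diag_mx L \in unitmx.
      by rewrite unitmxE det_diag unitfE; apply/prodf_neq0 => k _; exact: Lneq0.
    have -> : diag_mx L = (G^T *m V)^T *m (G^T *m V).
      by rewrite trmx_mul trmxK -mulmxA [G *m _]mulmxA BVL mulmxA VtV1 mul1mx.
    by rewrite unitmx_mul => /andP[].
  have PGM : P *m G *m (G^T *m V) = 0.
    by rewrite -mulmxA [G *m _]mulmxA BVL mulmxA PV mul0mx.
  by rewrite -[LHS](mulmxK Mu) PGM mul0mx.
(* Otherwise all eigenvalues beyond the first d vanish, so that the positive
   semidefinite matrix B - V L V^T has trace 0. *)
rewrite negb_and -ltnNge negb_forall => smallL.
have s0 j : (d <= j)%N -> s`_j = 0.
  move=> dj; have [js|js] := ltnP j (size s); last by rewrite nth_default.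
  (* If N < d, no index j >= d is left in the list; otherwise s_j lies between 0 and an earlier
     eigenvalue equal to 0. *)
  case/orP: smallL => [Nd|/existsP[k]].
    by move: js; rewrite sN ltnNge (leq_trans (ltnW Nd) dj).
  rewrite negbK Ls => /eqP sk0; apply/eqP; rewrite eq_le s_ge0 andbT -[leRHS]sk0.
  have kj : (k <= j)%N := leq_trans (ltnW (ltn_ord k)) dj.
  apply: (sorted_leq_nth ge_trans ge_refl 0 s_sorted) => //.
  by rewrite inE (leq_ltn_trans kj).
apply: mxtrace_mulmx_tr_eq0; rewrite PBP linearB /= (mxtrace_char_poly_roots Bs).
rewrite mxtrace_mulC mulmxA VtV mulmx_diag mxtrace_diag (big_nth 0) big_mkord sN.
(* The trace of [B] has N terms and that of V L V^T has d, so both sums are extended by zeros to a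
   common length. *)
have widen n : (n <= maxn d N)%N -> (forall j, (n <= j)%N -> s`_j = 0) ->
    \sum_(j < n) s`_j = \sum_(j < maxn d N) s`_j.
  move=> nM sn0; rewrite (big_ord_widen _ (fun j => s`_j) nM) big_mkcond /=.
  by apply: eq_bigr => j _; case: ltnP => // /sn0 ->.
rewrite widen ?leq_maxr //; last by move=> j Nj; rewrite nth_default ?sN.
rewrite -(widen d) ?leq_maxl //; apply/eqP; rewrite subr_eq0; apply/eqP.
apply: eq_bigr => k _; rewrite !mxE -Ls; have [kN|/L0 ->] := ltnP k N.
  by rewrite mul1r.
by rewrite mulr0.
Qed.

(** * Double centering of squared distances *)

Lemma mul_centering_const (R : realType) (N : nat) :
  centering R N *m const_mx 1 = 0 :> 'cV_N.
Proof.
apply/colP => i; rewrite mulmxBl mul1mx -scalemxAl !mxE.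
under eq_bigr do rewrite !mxE mulr1.
(* The index [i] witnesses N > 0. *)
rewrite sumr_const card_ord mulVf ?subrr // pnatr_eq0 -lt0n.
exact: leq_ltn_trans (ltn_ord i).
Qed.

Lemma tr_centering (R : realType) (N : nat) : (centering R N)^T = centering R N.
Proof. by rewrite /centering linearB linearZ /= trmx1 trmx_const. Qed.

(** By polarization |y_i - y_j|^2 = q_i + q_j - 2 <y_i, y_j> with q_i = |y_i|^2. Centering kills
    constant vectors, hence the first two terms, and -1/2 cancels the factor -2. *)
Lemma double_centering_sqdist (R : realType) (N d : nat) (Y : 'M[R]_(N, d)) :
  - (2^-1) *: (centering R N *m
    (\matrix_(i, j) eucl_dist (row i Y) (row j Y) ^+ 2) *m centering R N) =
  (centering R N *m Y) *m (centering R N *m Y)^T.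
Proof.
set H := centering R N; set D := \matrix_(i, j) _.
pose q : 'cV[R]_N := \col_i (Y *m Y^T) i i.
pose e : 'cV[R]_N := const_mx 1.
have -> : D = q *m e^T + e *m q^T - 2 *: (Y *m Y^T).
  apply/matrixP => i j; rewrite /eucl_dist /eucl_norm !mxE !big_ord1 !mxE.
  rewrite sqr_sqrtr; last by apply: sumr_ge0 => k _; exact: sqr_ge0.
  rewrite mulr1 mul1r mulr_sumr -big_split -sumrB; apply: eq_bigr => k _ /=.
  by rewrite !mxE; ring.
have eH : e^T *m H = 0.
  by apply: trmx_inj; rewrite trmx_mul trmxK tr_centering mul_centering_const trmx0.
rewrite [H *m (_ - _)]mulmxBr [H *m (_ + _)]mulmxDr.
rewrite [H *m (e *m _)]mulmxA mul_centering_const mul0mx addr0.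
rewrite [(_ - _) *m H]mulmxBl -!mulmxA eH !mulmx0 sub0r -scalemxAl -scalemxAr scalerN scaleNr.
rewrite opprK scalerA mulVf ?pnatr_eq0 // scale1r trmx_mul tr_centering.
by rewrite !mulmxA.
Qed.

Theorem corollary3p3 (R : realType) (m d N : nat) (p : R) (hp : 1 < p)
    (Theta : set 'rV[R]_d)
    (mu : 'rV[R]_d -> probability (borelRV R m) R)
    (hmu : mu @` Theta `<=` wasserstein_space p)
    (hiso : exists2 c : R, 0 < c &
      forall t t' : 'rV[R]_d, Theta t -> Theta t' ->
        wasserstein p (mu t) (mu t') = (c * eucl_dist t t')%:E)
    (theta : 'I_N -> 'rV[R]_d) (htheta : forall i, Theta (theta i)) :
  recovers_rigid_scaling p (fun i => mu (theta i)) theta.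
Proof.
(* The global scaling is the isometry constant [c]. *)
have [c c_gt0 iso] := hiso; exists c => // L z [V [decV zV]].
set Y : 'M[R]_(N, d) := \matrix_i (c *: theta i).
set G := centering R N *m Y.
have distE i j : fine (wasserstein p (mu (theta i)) (mu (theta j))) =
    eucl_dist (row i Y) (row j Y).
  rewrite iso //= !rowK /eucl_dist /eucl_norm -scalerBr.
  under [in RHS]eq_bigr do rewrite mxE exprMn.
  by rewrite -mulr_sumr sqrtrM ?sqr_ge0 // sqrtr_sqr gtr0_norm.
have gramE : wassmap_gram p (fun i => mu (theta i)) = G *m G^T.
  rewrite -double_centering_sqdist /wassmap_gram; congr (_ *: (_ *m _ *m _)).
  by apply/matrixP => i j; rewrite !mxE distE.
rewrite gramE in decV; have [L_ge0 VLV] := truncated_eigendecomposition_gram decV.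
split=> //; set S := diag_mx (map_mx Num.sqrt L) in zV.
(* The square roots are genuine because the entries of [L] are nonnegative. *)
have SS : S *m S^T = diag_mx L.
  rewrite tr_diag_mx mulmx_diag; congr diag_mx; apply/rowP => k; rewrite !mxE.
  by rewrite -expr2 sqr_sqrtr.
have [Q QQ GQ] : exists2 Q : 'M[R]_d, Q *m Q^T = 1%:M & G *m Q = V *m S.
  by apply: gram_eq_orthogonal; rewrite [(V *m S)^T]trmx_mul mulmxA -(mulmxA V) SS.
(* Row i of [G] is c theta_i minus the barycentre, so the translation is minus the barycentre moved
   by [Q]. The transpose appears because rigid motions act on rows by the transposed matrix. *)
exists Q^T, (- (N%:R^-1 *: (\sum_i c *: theta i)) *m Q).
rewrite trmxK; split=> // i.
rewrite zV -GQ row_mul -mulmxDl; congr (_ *m _).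
rewrite /G mulmxBl mul1mx [LHS]linearB /= rowK -scalemxAl [row i (_ *: _)]linearZ /=.
congr (_ - _ *: _); rewrite row_mul mulmx_sum_row; apply: eq_bigr => j _.
by rewrite rowK !mxE scale1r.
Qed.
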